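(* Let $\ell\ge 1$ be an integer and let $\lambda=(\lambda_1,\ldots,\lambda_\ell)$ be a partition with at most $\ell$ parts (so $\lambda_1\ge\cdots\ge\lambda_\ell\ge0$). Then $$\sum_{\mu}K^{(-1)}_{\mu\lambda}\,q^{\frac{\mu^2}{2}}+\sum_{r=1}^{\ell-1}\ \sum_{l(\mu)<\ell}K^{(-1)}_{\mu,\lambda+(r^\ell)}\,q^{\frac{\sum_{i=1}^\ell(\mu_i-r)^2}{2}}=q^{\frac{\lambda^2}{2}}\prod_{1\le i<j\le\ell}\big(1-q^{\lambda_i-\lambda_j+j-i}\big),$$ where the $\mu$'s are partitions and $l(\mu)$ denotes the length of $\mu$. In particular, if $\lambda$ is the trivial partition, $$\sum_{r=0}^{\ell-1}\ \sum_{l(\mu)<\ell}K^{(-1)}_{\mu,(r^\ell)}\,q^{\frac{\sum_{i=1}^\ell(\mu_i-r)^2}{2}}=\prod_{1\le i<j\le\ell}\big(1-q^{j-i}\big).$$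
   Context: Here $q$ is a formal parameter. $\mu^2=\sum_i\mu_i^2$; $l(\mu)$ is the number of non-zero parts of $\mu$, and $\mu_i=0$ for $i>l(\mu)$. $(r^\ell)$ is the partition with $\ell$ parts equal to $r$ and $\lambda+(r^\ell)=(\lambda_1+r,\ldots,\lambda_\ell+r)$. The Kostka numbers $K_{\lambda\mu}$ of partitions are defined by $s_\lambda=\sum_\mu K_{\lambda\mu}m_\mu$ ($s$ Schur functions, $m$ monomial symmetric functions), and the inverse Kostka matrix is determined by $m_\mu=\sum_\lambda K^{(-1)}_{\mu\lambda}s_\lambda$; $K^{(-1)}_{\mu\lambda}=0$ unless $|\mu|=|\lambda|$. *)

(* Defs.v *)
From HB Require Import structures.
From mathcomp Require Import all_boot all_order all_fingroup all_algebra.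
From mathcomp Require Import zify mpoly.

Set Implicit Arguments.
Unset Strict Implicit.
Unset Printing Implicit Defensive.

Import GRing.Theory.
Local Open Scope ring_scope.

(* A partition is the weakly decreasing list of its nonzero parts: [size mu]
   is l(mu), [sumn mu] is |mu|, and the part mu_(i+1) is [nth 0 mu i], which is
   0 beyond the length. *)
Definition is_part (s : seq nat) := sorted geq s && (0%N \notin s).

Record intpart := IntPart { parts :> seq nat; _ : is_part parts }.

HB.instance Definition _ := [isSub for parts].
HB.instance Definition _ := [Choice of intpart by <:].

Implicit Types (mu la : intpart).

Lemma is_part_sort (s : seq nat) :
  is_part (sort geq [seq x <- s | (0 < x)%N]).
Proof.
by rewrite /is_part sort_sorted ?mem_sort ?mem_filter // => x y; apply: leq_total.
Qed.

(* The partition formed by the nonzero entries of a sequence. *)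
Definition part_of (s : seq nat) : intpart := IntPart (is_part_sort s).

(* See [mem_partitions] and [partitions_uniq]. *)
Definition partitions (d : nat) : seq intpart :=
  undup [seq part_of (map val t)
        | t : d.-tuple 'I_d.+1 in [pred t : d.-tuple 'I_d.+1 |
                                   sumn (map val t) == d]].

Lemma geq_total : total geq. Proof. by move=> x y; apply: leq_total. Qed.
Lemma geq_trans : transitive geq. Proof. by move=> x y z /= a b; apply: leq_trans b a. Qed.
Lemma geq_asym : antisymmetric geq. Proof. by move=> x y /= /andP[a b]; apply/eqP; rewrite eqn_leq a b. Qed.

Lemma part_of_perm (s t : seq nat) : perm_eq s t -> part_of s = part_of t.
Proof.
move=> st; apply: val_inj => /=.
apply/perm_sortP; [exact: geq_total|exact: geq_trans|exact: geq_asym|].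
exact: perm_filter.
Qed.

Lemma sumn_part_of (s : seq nat) : sumn (part_of s) = sumn s.
Proof.
rewrite /= (perm_sumn (s2 := [seq x <- s | (0 < x)%N])) ?perm_sort //.
by elim: s => //= -[|x] s IH //=; rewrite IH.
Qed.

Lemma part_of_part (la : intpart) : part_of la = la.
Proof.
apply: val_inj => /=; case/andP: (valP la) => s0 z.
rewrite (_ : [seq x <- la | (0 < x)%N] = la).
  exact: sorted_sort geq_trans _ _.
apply/all_filterP/allP => x xl; rewrite lt0n; apply: contraNneq z => <-; exact: xl.
Qed.

Lemma part_of_cat0 s k : part_of (s ++ nseq k 0%N) = part_of s.
Proof. by apply: val_inj => /=; rewrite filter_cat filter_nseq /= cats0. Qed.

Lemma size_part (la : intpart) : (size la <= sumn la)%N.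
Proof.
case/andP: (valP la) => _ /=; elim: (val la) => //= x s IH.
by rewrite inE negb_or eq_sym => /andP[x0 /IH] h; move: x0; lia.
Qed.

Lemma mem_partitions d (mu : intpart) : (mu \in partitions d) = (sumn mu == d).
Proof.
rewrite mem_undup; apply/mapP/eqP => [[t]|h].
  by rewrite mem_enum inE => /eqP st ->; rewrite sumn_part_of.
pose s := map (@inord d) mu ++ nseq (d - size mu) ord0.
have sz : size s == d.
  rewrite size_cat size_map size_nseq; have := size_part mu; rewrite h; lia.
have vs : map val (Tuple sz) = mu ++ nseq (d - size mu) 0%N.
  rewrite /= map_cat map_nseq -map_comp; congr (_ ++ _).
  rewrite -[RHS]map_id; apply/eq_in_map => x xm /=; rewrite inordK // ltnS -h.
  by elim: (val mu) xm => //= y l IH; rewrite inE => /orP[/eqP->|/IH]; lia.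
exists (Tuple sz); last by rewrite vs part_of_cat0 part_of_part.
by rewrite mem_enum inE vs sumn_cat sumn_nseq mul0n addn0 h.
Qed.

Lemma partitions_uniq d : uniq (partitions d). Proof. exact: undup_uniq. Qed.

(* The monomial symmetric polynomial m_mu(x_1, ..., x_n): the sum of the
   monomials whose nonzero exponents form mu (0 if l(mu) > n). *)
Definition mono (n : nat) (mu : intpart) : {mpoly int[n]} :=
  \sum_(a : 'X_{1..n < (sumn mu).+1} | part_of (bmnm a) == mu) 'X_[a].

Definition alternant (n : nat) (a : 'X_{1..n}) : {mpoly int[n]} :=
  \det (\matrix_(i < n, j < n) 'X_i ^+ a j).

Definition part_mon (n : nat) (la : intpart) : 'X_{1..n} :=
  [multinom nth 0%N la i | i < n].

Definition delta (n : nat) : 'X_{1..n} := [multinom (n - i.+1)%N | i < n].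

(* The Schur polynomial s_la(x_1, ..., x_n), as the quotient of alternants
   a_(la + delta) / a_delta, and 0 if l(la) > n. *)
Definition schur (n : nat) (la : intpart) : {fraction {mpoly int[n]}} :=
  if (size la <= n)%N then
    tofrac (alternant (part_mon n la + delta n)%MM)
      / tofrac (alternant (delta n))
  else 0.

(* m_mu = \sum_la K mu la s_la as symmetric functions, i.e. in every number n
   of variables. *)
Definition is_inv_kostka (K : intpart -> intpart -> int) : Prop :=
  (forall mu la, sumn mu != sumn la -> K mu la = 0) /\
  (forall (n : nat) (mu : intpart), tofrac (mono n mu) =
     \sum_(la <- partitions (sumn mu)) (K mu la)%:~R * schur n la).

(* Existence: a_delta m_mu is antisymmetric, hence the sum of the a_(la + delta)
   weighted by its coefficients at the monomials x^(la + delta); these do not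
   depend on the number of variables as long as it is at least l(la). *)

Local Notation "m # s" := [multinom m (s i) | i < _]
  (at level 40, left associativity, format "m # s").

Lemma perm_mperm n (m : 'X_{1..n}) (s : 'S_n) : perm_eq (m#s) m.
Proof.
by apply/tuple_permP; exists s.
Qed.

Lemma alternantE n (a : 'X_{1..n}) :
  alternant a = \sum_(s : 'S_n) (-1) ^+ s *: 'X_[a#s].
Proof.
rewrite /alternant /determinant; apply: eq_bigr => s _.
rewrite mulr_sign scaler_sign [in RHS]mpolyXE_id.
have -> : \prod_i (\matrix_(i0 < n, j < n) ('X_i0 ^+ a j : {mpoly int[n]})) i (s i) =
  \prod_(i < n) 'X_i ^+ (a#s) i by apply: eq_bigr => i _; rewrite mxE mnmE.
by [].
Qed.

Lemma mcoeff_mono n mu (m : 'X_{1..n}) : (mono n mu)@_m = (part_of m == mu)%:R.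
Proof.
rewrite /mono raddf_sum /=.
have [h|h] := eqVneq (part_of m) mu; last first.
  rewrite big1 // => a /eqP pa; rewrite mcoeffX; case: eqP => // E.
  by rewrite -E pa eqxx in h.
have dm : (mdeg m < (sumn mu).+1)%N by rewrite -h sumn_part_of /mdeg sumnE.
rewrite (bigD1 (BMultinom dm)) /= ?h //.
rewrite mcoeffX eqxx big1 ?addr0 // => a /andP[_ ne]; rewrite mcoeffX.
by case: eqP => // E; case/eqP: ne; apply: val_inj.
Qed.

Lemma mcoeffMXn n (p : {mpoly int[n]}) (m k : 'X_{1..n}) :
  (p * 'X_[m])@_k = if (m <= k)%MM then p@_(k - m)%MM else 0.
Proof.
case: ifP => h; first by rewrite -{1}(submK h) addmC mcoeffMX.
apply/eqP; rewrite mcoeff_eq0 (perm_mem (msuppMX _ _)); apply/mapP => -[m' _ E].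
by rewrite E lem_addr in h.
Qed.

Definition kostka_coef n (mu : intpart) (g : 'X_{1..n}) : int :=
  \sum_(s : 'S_n) (-1) ^+ s *
    ((delta n # s <= g)%MM && (part_of (g - delta n # s)%MM == mu))%:R.

Lemma mcoeff_mono_alt n mu g : (mono n mu * alternant (delta n))@_g = kostka_coef mu g.
Proof.
rewrite alternantE mulr_sumr raddf_sum; apply: eq_bigr => s _ /=.
rewrite -scalerAr mcoeffZ mcoeffMXn; congr (_ * _).
by case: ifP => // h; rewrite mcoeff_mono.
Qed.

Definition antisym n (p : {mpoly int[n]}) :=
  forall (s : 'S_n) (m : 'X_{1..n}), p@_(m#s) = (-1) ^+ s * p@_m.

Lemma antisym_alt n (a : 'X_{1..n}) : antisym (alternant a).
Proof.
move=> s m; rewrite alternantE !raddf_sum mulr_sumr /=.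
rewrite (reindex_inj (mulgI s)) /=; apply: eq_bigr => t _.
rewrite !mcoeffZ !mcoeffX odd_permM signr_addb -mulrA; do 2 congr (_ * _).
have -> : a#(s * t)%g = (a#t)#s by apply/mnmP => i; rewrite !mnmE permM.
congr (nat_of_bool _)%:R; apply/eqP/eqP => [/mnmP E|->//]; apply/mnmP => i.
by have := E (s^-1 i)%g; rewrite !mnmE permKV.
Qed.

Lemma antisym_monoalt n mu (a : 'X_{1..n}) : antisym (mono n mu * alternant a).
Proof.
move=> s m; rewrite -!mcoeff_sym msymM.
have -> : msym s (mono n mu) = mono n mu.
  apply/mpolyP => k; rewrite mcoeff_sym !mcoeff_mono.
  by rewrite (part_of_perm (perm_mperm k s)).
have -> : msym s (alternant a) = (-1) ^+ s *: alternant a.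
  by apply/mpolyP => k; rewrite mcoeff_sym mcoeffZ antisym_alt.
by rewrite -scalerAr mcoeffZ.
Qed.

Lemma delta_tail n (m : 'X_{1..n}) :
  (forall i j : 'I_n, (i < j)%N -> (m j < m i)%N) -> 
  exists2 la : intpart, (size la <= n)%N & m = (part_mon n la + delta n)%MM.
Proof.
move=> dec.
pose f i := (nth 0 m i - (n - i.+1))%N.
have nthm (i : 'I_n) : nth 0%N m i = m i by rewrite (mnm_nth 0%N).
have dom (i : nat) : (i < n)%N -> (n - i.+1 <= nth 0 m i)%N.
  move=> lt_i; have [k E] : exists k, (n - i.+1 = k)%N by exists (n - i.+1)%N.
  elim: k i lt_i E => [|k IH] i lt_i E; first by rewrite E.
  have lt_i1 : (i.+1 < n)%N by lia.
  have := dec (Ordinal lt_i) (Ordinal lt_i1) (leqnn _).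
  rewrite -!nthm /=; have := IH _ lt_i1; lia.
have fdec i : (i.+1 < n)%N -> (f i.+1 <= f i)%N.
  move=> lt_i1; have lt_i : (i < n)%N by lia.
  have := dec (Ordinal lt_i) (Ordinal lt_i1) (leqnn _).
  rewrite -!nthm /f /=; lia.
have sf : sorted geq (mkseq f n).
  apply/(sortedP 0%N) => i; rewrite size_mkseq => h; rewrite !nth_mkseq //; last by lia.
  exact: fdec.
exists (part_of (mkseq f n)).
  by rewrite /= size_sort size_filter -[X in (_ <= X)%N](size_mkseq f n) count_size.
apply/mnmP => i; rewrite !mnmE -nthm.
have -> : nth 0%N (part_of (mkseq f n)) i = f i; last by rewrite /f subnK // dom.
rewrite -(nth_mkseq 0%N f (ltn_ord i)) /=.
rewrite sorted_sort; [|exact: geq_trans|exact: sorted_filter geq_trans _ _ sf].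
elim: (mkseq f n) (i : nat) sf => //= x s IH k pk.
case: x pk => [|x] pk /=; last by case: k => //= k; apply: IH; exact: path_sorted pk.
have s0 : all (pred1 0%N) s.
  by have := order_path_min geq_trans pk; apply: sub_all => y /=; rewrite leqn0.
rewrite (_ : [seq _ <- s | _] = [::]); last first.
  by apply/eqP; rewrite -[_ == _]negbK -has_filter; apply/hasPn => y /(allP s0)/eqP ->.
rewrite nth_nil; case: k => //= k; case: (ltnP k (size s)) => hk; last by rewrite nth_default.
by have /eqP-> := allP s0 _ (mem_nth 0%N hk).
Qed.
Definition topmon n (la : intpart) := (part_mon n la + delta n)%MM.

Lemma kostka_coef_stable n (mu la : intpart) : (size la <= n)%N ->
  kostka_coef mu (topmon n.+1 la) = kostka_coef mu (topmon n la).
Proof.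
move=> sz; rewrite /kostka_coef (bigID (fun s : 'S_n.+1 => s ord_max == ord_max)) /=.
rewrite [X in _ + X]big1 ?addr0; last first.
  move=> s ne; case: mnm_lepP => [/(_ ord_max)|]; last by rewrite mulr0.
  rewrite !mnmE /= (nth_default _ sz) => h; case/eqP: ne; apply: val_inj => /=.
  have := ltn_ord (s ord_max); move: h; lia.
rewrite (reindex (lift_perm ord_max ord_max)); last first.
  pose ulsf i (s : 'S_n.+1) k := odflt k (unlift (s i) (s (lift i k))).
  have ulsfK i (s : 'S_n.+1) k : lift (s i) (ulsf i s k) = s (lift i k).
    rewrite /ulsf; have:= neq_lift i k.
    by rewrite -(can_eq (permK s)) => /unlift_some[] ? ? ->.
  have inj_ulsf: injective (ulsf ord_max _).
    move=> s; apply: can_inj (ulsf (s ord_max) s^-1%g) _ => k'.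
    by rewrite {1}/ulsf ulsfK !permK liftK.
  exists (fun s => perm (inj_ulsf s)) => [s _ | s].
    by apply/permP=> k'; rewrite permE /ulsf lift_perm_lift lift_perm_id liftK.
  move/(s _ =P _) => si0; apply/permP=> k.
  case: (unliftP ord_max k) => [k'|] ->; rewrite ?lift_perm_id //.
  by rewrite lift_perm_lift permE; have := ulsfK ord_max s k'; rewrite si0.
apply: eq_big => [s | s _]; first by rewrite lift_perm_id eqxx.
rewrite odd_lift_perm addbb /=; congr (_ * _).
set A := delta n.+1 # _; set B := delta n # _.
have AE (i : 'I_n) : A (lift ord_max i) = (B i).+1.
  by rewrite !mnmE lift_perm_lift lift_max; have := ltn_ord (s i); lia.
have TE (i : 'I_n) : topmon n.+1 la (lift ord_max i) = (topmon n la i).+1.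
  by rewrite !mnmE lift_max; have := ltn_ord i; lia.
have A0 : A ord_max = 0%N by rewrite !mnmE lift_perm_id /= subnn.
have T0 : topmon n.+1 la ord_max = 0%N by rewrite !mnmE /= subnn (nth_default _ sz).
have -> : (A <= topmon n.+1 la)%MM = (B <= topmon n la)%MM.
  apply/mnm_lepP/mnm_lepP => h i; first by have := h (lift ord_max i); rewrite AE TE.
  by case: (unliftP ord_max i) => [j|] ->; rewrite ?AE ?TE ?A0 // ltnS h.
have -> // : part_of (topmon n.+1 la - A)%MM = part_of (topmon n la - B)%MM.
move: (fun i => mnmBE i (topmon n.+1 la) A) (fun i => mnmBE i (topmon n la) B).
move: (topmon n.+1 la - A)%MM (topmon n la - B)%MM => M N ME NE.
rewrite -(part_of_cat0 N 1); congr part_of.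
apply: (@eq_from_nth _ 0%N) => [|i]; rewrite ?size_cat ?size_tuple /= ?addn1 // => lt_i.
have -> : i = Ordinal lt_i by [].
rewrite -mnm_nth; case: (unliftP ord_max (Ordinal lt_i)) => [j|] ->; rewrite ME.
  by rewrite AE TE subSS lift_max nth_cat size_tuple ltn_ord -mnm_nth NE.
by rewrite A0 T0 nth_cat size_tuple ltnn !subnn.
Qed.

Lemma kostka_coef_stableD k (mu la : intpart) :
  kostka_coef mu (topmon (k + size la) la) = kostka_coef mu (topmon (size la) la).
Proof. by elim: k => // k IH; rewrite addSn kostka_coef_stable ?IH // leq_addl. Qed.

Definition inv_kostka_coef (mu la : intpart) : int := kostka_coef mu (topmon (size la) la).

Lemma kostka_coefE n mu la : (size la <= n)%N -> kostka_coef mu (topmon n la) = inv_kostka_coef mu la.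
Proof. by move=> h; have := kostka_coef_stableD (n - size la) mu la; rewrite subnK. Qed.

Lemma mdeg_topmon n la : (size la <= n)%N -> mdeg (topmon n la) = (sumn la + mdeg (delta n))%N.
Proof.
move=> h; rewrite mdegD; congr (_ + _)%N.
rewrite mdegE -{2}(part_of_part la) -(part_of_cat0 la (n - size la)) sumn_part_of.
rewrite sumnE (big_nth 0%N) size_cat size_nseq subnKC // big_mkord.
by apply: eq_bigr => i _; rewrite mnmE nth_cat nth_nseq; case: ltnP => // l; rewrite nth_default // if_same.
Qed.

Lemma kostka_coef_deg n mu la : (size la <= n)%N -> sumn mu != sumn la -> kostka_coef mu (topmon n la) = 0.
Proof.
move=> h ne; rewrite /kostka_coef big1 // => s _; case: andP => [[le /eqP E]|]; last by rewrite mulr0.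
case/eqP: ne; rewrite -E sumn_part_of.
have -> : sumn (topmon n la - delta n # s)%MM = mdeg (topmon n la - delta n # s)%MM by rewrite /mdeg sumnE.
have := congr1 (@mdeg n) (submK le); rewrite mdegD mdeg_mperm mdeg_topmon //; lia.
Qed.

Lemma nth_cat0 (s : seq nat) k i : nth 0%N (s ++ nseq k 0%N) i = nth 0%N s i.
Proof. by rewrite nth_cat nth_nseq if_same; case: ltnP => // h; rewrite nth_default. Qed.

Lemma topmon_inj n la la' : (size la <= n)%N -> (size la' <= n)%N ->
  topmon n la = topmon n la' -> la = la'.
Proof.
move=> h h' /mnmP E.
rewrite -(part_of_part la) -(part_of_part la') -(part_of_cat0 la (n - size la)) -(part_of_cat0 la' (n - size la')).
congr part_of; apply: (@eq_from_nth _ 0%N) => [|i]; rewrite !size_cat !size_nseq ?subnKC // => lt_i.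
have := E (Ordinal lt_i); rewrite !mnmE /= => /addIn e.
by rewrite !nth_cat0 e.
Qed.

Lemma topmon_dec n (la : intpart) (i j : 'I_n) : (i < j)%N -> (topmon n la j < topmon n la i)%N.
Proof.
move=> lt; rewrite !mnmE.
have : (nth 0 la j <= nth 0 la i)%N; last by have := ltn_ord j; lia.
case: (ltnP j (size la)) => hj; last by rewrite nth_default.
case/andP: (valP la) => s0 _.
by apply: (sorted_leq_nth geq_trans leqnn 0%N s0); rewrite ?unfold_in /=; [exact: ltn_trans lt hj|exact: hj|exact: ltnW].
Qed.

Lemma dec_perm_id n (a b : 'X_{1..n}) (s : 'S_n) :
  (forall i j : 'I_n, (i < j)%N -> (a j < a i)%N) ->
  (forall i j : 'I_n, (i < j)%N -> (b j < b i)%N) ->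
  a # s = b -> s = 1%g.
Proof.
move=> da db E.
have inc (i j : 'I_n) : (i < j)%N -> (s i < s j)%N.
  move=> lt; have := db _ _ lt; rewrite -E !mnmE => h.
  case: (ltngtP (s i) (s j)) => // [/da|/val_inj e]; first by lia.
  by rewrite e ltnn in h.
have geq_id k : forall i : 'I_n, (i = k :> nat) -> (k <= s i)%N.
  elim: k => // k IH i ik.
  have lk : (k < n)%N by have := ltn_ord i; lia.
  have := inc (Ordinal lk) i; have := IH (Ordinal lk) erefl; rewrite ik /=; lia.
have leq_id k : forall i : 'I_n, (i + k.+1 = n)%N -> (s i <= i)%N.
  elim: k => [|k IH] i ik; first by have := ltn_ord (s i); lia.
  have lk : (i.+1 < n)%N by lia.
  have := inc i (Ordinal lk); have := IH (Ordinal lk); rewrite /=; lia.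
apply/permP => i; rewrite perm1; apply: val_inj; apply/eqP; rewrite eqn_leq geq_id // andbT.
by apply: (leq_id (n - i.+1)%N); have := ltn_ord i; lia.
Qed.

Lemma mcoeff_alt_top n la la' : (size la <= n)%N -> (size la' <= n)%N ->
  (alternant (topmon n la))@_(topmon n la') = (la == la')%:R.
Proof.
move=> h h'; rewrite alternantE raddf_sum /= (bigD1 1%g) //= big1 ?addr0 => [|s ne].
  rewrite odd_perm1 scale1r mcoeffX; congr (nat_of_bool _)%:R.
  have -> : topmon n la # (1%g : 'S_n) = topmon n la by apply/mnmP => i; rewrite !mnmE perm1.
  by apply/eqP/eqP => [|->//]; apply: topmon_inj.
rewrite mcoeffZ mcoeffX; case: eqP; rewrite ?mulr0 // => e; case/eqP: ne.
by apply: dec_perm_id e; apply: topmon_dec.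
Qed.

Lemma antisym_eq n (p q : {mpoly int[n]}) : antisym p -> antisym q ->
  (forall la : intpart, (size la <= n)%N -> p@_(topmon n la) = q@_(topmon n la)) -> p = q.
Proof.
move=> ap aq E; apply/mpolyP => m.
have [inj|ninj] := boolP (injectiveb m); last first.
  case/injectivePn: ninj => i [j ne e].
  suff z r : antisym r -> r@_m = 0 by rewrite !z.
  move=> ar; have := ar (tperm i j) m; rewrite odd_tperm ne expr1 mulN1r.
  have -> : m # (tperm i j) = m.
    by apply/mnmP => k; rewrite mnmE; case: tpermP => [->|->|]; rewrite ?e.
  by lia.
move/injectiveP: inj => inj.
have sz : size (sort geq m) == n by rewrite size_sort size_tuple.
have /tuple_permP[s es] : perm_eq (Tuple sz) m by rewrite /= perm_sort.
have ms : sort geq m = m # s by exact: es.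
have dec (i j : 'I_n) : (i < j)%N -> ((m # s) j < (m # s) i)%N.
  move=> lt; rewrite ltn_neqAle; apply/andP; split.
    by rewrite !mnmE (inj_eq inj) (inj_eq perm_inj) -val_eqE /= gtn_eqF.
  rewrite !(mnm_nth 0%N) -ms; apply: (sorted_leq_nth geq_trans leqnn 0%N (sort_sorted geq_total _)); rewrite ?inE ?size_sort ?size_tuple //.
  exact: ltnW.
have [la szl ela] := delta_tail dec.
have := E la szl; rewrite /topmon -ela ap aq => /(congr1 ( *%R ((-1) ^+ s))).
by rewrite !mulrA -!expr2 !sqrr_sign !mul1r.
Qed.

Lemma mcoeff_intM n (c : int) (p : {mpoly int[n]}) m : (c%:~R * p)@_m = c * p@_m.
Proof. by rewrite mulrzl -scaler_int mcoeffZ intz. Qed.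

Lemma mono_alt n mu : mono n mu * alternant (delta n) =
  \sum_(la <- partitions (sumn mu) | (size la <= n)%N) (inv_kostka_coef mu la)%:~R * alternant (topmon n la).
Proof.
apply: antisym_eq; first exact: antisym_monoalt.
  move=> s m; rewrite !raddf_sum mulr_sumr; apply: eq_bigr => la _ /=.
  by rewrite !mcoeff_intM antisym_alt mulrCA.
move=> la h; rewrite mcoeff_mono_alt raddf_sum /=.
have co la' : (size la' <= n)%N -> ((inv_kostka_coef mu la')%:~R * alternant (topmon n la'))@_(topmon n la)
  = if la' == la then inv_kostka_coef mu la else 0.
  move=> h'; rewrite mcoeff_intM mcoeff_alt_top //; case: eqP => [->|_]; by rewrite ?mulr0 ?mulr1.
rewrite (eq_bigr _ co) -big_mkcondr /=.
case: (eqVneq (sumn mu) (sumn la)) => e; last first.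
  rewrite kostka_coef_deg // big1_seq // => la' /andP[/andP[_ /eqP->]]; rewrite mem_partitions => /eqP E.
  by rewrite E eqxx in e.
rewrite (big_rem la) /=; last by rewrite mem_partitions e.
rewrite h eqxx kostka_coefE // big1_seq ?addr0 // => la' /andP[/andP[_ /eqP->]].
by rewrite mem_rem_uniqF // partitions_uniq.
Qed.

Lemma alternant_delta_neq0 n : alternant (delta n) != 0.
Proof.
have e0 : is_part [::] by [].
have E : topmon n (IntPart e0) = delta n by apply/mnmP => i; rewrite !mnmE nth_nil.
apply: contra_eqN (mcoeff_alt_top (n := n) (la := IntPart e0) (la' := IntPart e0) isT isT) => /eqP.
by rewrite E => ->; rewrite mcoeff0 eqxx.
Qed.

Lemma inv_kostka_exists : {K | is_inv_kostka K}.
Proof.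
exists inv_kostka_coef; split=> [mu la ne|n mu]; first exact: kostka_coef_deg.
have nz : tofrac (alternant (delta n)) != 0 by rewrite tofrac_eq0 alternant_delta_neq0.
apply: (mulIf nz); rewrite -tofracM mono_alt raddf_sum /= mulr_suml big_mkcond /=.
apply: eq_bigr => la _; rewrite /schur /topmon; case: ifP => h; last by rewrite mulr0 mul0r.
by rewrite tofracM rmorph_int -!mulrA mulVf // mulr1.
Qed.

Lemma inv_kostka_unique (K1 K2 : intpart -> intpart -> int) :
  is_inv_kostka K1 -> is_inv_kostka K2 -> forall mu la, K1 mu la = K2 mu la.
Proof.
suff H K : is_inv_kostka K -> forall mu la, K mu la = inv_kostka_coef mu la.
  by move=> h1 h2 mu la; rewrite !H.
case=> K0 Ks mu la; have [e|ne] := eqVneq (sumn mu) (sumn la); last first.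
  by rewrite K0 // [RHS]kostka_coef_deg.
pose n := size la; have nz : tofrac (alternant (delta n)) != 0.
  by rewrite tofrac_eq0 alternant_delta_neq0.
have E : mono n mu * alternant (delta n) = \sum_(k <- partitions (sumn mu)
    | (size k <= n)%N) (K mu k)%:~R * alternant (topmon n k).
  apply/eqP; rewrite -tofrac_eq tofracM Ks [X in _ == X]raddf_sum /= mulr_suml.
  rewrite [X in _ == X]big_mkcond /=; apply/eqP/eq_bigr => k _.
  rewrite /schur /topmon; case: ifP => h; last by rewrite mulr0 mul0r.
  by rewrite tofracM rmorph_int -!mulrA mulVf // mulr1.
have := congr1 (mcoeff (topmon n la)) E.
rewrite mcoeff_mono_alt kostka_coefE // => ->.
rewrite raddf_sum /= (big_rem la) /=; last by rewrite mem_partitions e.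
rewrite leqnn mcoeff_intM mcoeff_alt_top // eqxx mulr1 big1_seq ?addr0 //.
move=> k /andP[kn]; rewrite mem_rem_uniq ?partitions_uniq // inE => /andP[ne _].
by rewrite mcoeff_intM mcoeff_alt_top // (negbTE ne) mulr0.
Qed.

(* K^(-1)_(mu, la) *)
Definition inv_kostka : intpart -> intpart -> int := sval inv_kostka_exists.

Lemma inv_kostkaP : is_inv_kostka inv_kostka.
Proof. exact: svalP inv_kostka_exists. Qed.

(* Exponents lie in (1/2)N, so identities are stated in Z[q^(1/2)], and
   q^(a/2) is written [qhalf ^+ a]. *)
Definition qhalf : {poly int} := 'X.
Definition q : {poly int} := qhalf ^+ 2.

(* mu^2 *)
Definition sqnorm (mu : intpart) : nat := (\sum_(x <- parts mu) x ^ 2)%N.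

(* \sum_(1 <= i <= l) (mu_i - r)^2, with differences taken in Z *)
Definition sqdist (l r : nat) (mu : intpart) : nat :=
  (\sum_(i < l) absz ((nth 0%N mu i)%:Z - r%:Z)%R ^ 2)%N.

(* The partition (r^l); it is empty if r = 0. *)
Definition rect (l r : nat) : intpart := part_of (nseq l r).

(* la + (r^l), for l(la) <= l *)
Definition add_rect (l r : nat) (la : intpart) : intpart :=
  part_of (mkseq (fun i => (nth 0%N la i + r)%N) l).

(* Main.v *)
Require Import Defs.
From mathcomp Require Import all_boot all_order all_fingroup all_algebra.
From mathcomp Require Import zify mpoly.

Set Implicit Arguments.
Unset Strict Implicit.
Unset Printing Implicit Defensive.

Import GRing.Theory.
Local Open Scope ring_scope.

(** Both sides are one alternating sum over the symmetric group.

Put [p_i = la_i + l - 1 - i] (the entries of [topmon l la]) and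
[d_j = l - 1 - j] (those of [delta l]), with indices from 0.  Extracting the
coefficient of x^p in [m_mu * a_delta] shows that the inverse Kostka number
of (mu, la) is the sum of the signs of the permutations [s] for which the
vector [x(s)], with entries [x_i = p_i - d_(s i) = la_i + s(i) - i], has no
negative entry and rearranges to mu.  A sum over mu weighted by inverse Kostka
numbers is therefore a signed sum over permutations ([sum_inv_kostka]).

Replacing la by la + (r^l) replaces [x(s)] by [x(s) + r], and the shift by [r]
in the exponent undoes this, so that [s] always contributes the same term
[(-1)^s q^(|x(s)|^2 / 2)].  What changes with [r] is which [s] contribute: the
entries of [x(s) + r] must be nonnegative, and the condition l(mu) < l says
that one of them vanishes, that is, the least entry of [x(s)] is [-r].  For
[r = 0] the first sum only asks that no entry be negative.  As
[x_i >= - (l - 1)], each permutation is counted exactly once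
([sum_all_depths]).

Finally, the sum of [s(i)^2] does not depend on [s], so [|x(s)|^2] is a
constant plus [2 \sum_i (la_i - i) s(i)].  The signed sum is then the
Vandermonde determinant in the variables [q^(la_i - i)] up to a power of [q],
and the Vandermonde formula gives the product ([sum_weight]). *)

(** * Inverse Kostka numbers as signed sums over permutations *)

Implicit Types mu la : intpart.

Local Notation "m # s" := [multinom m (s i) | i < _]
  (at level 40, left associativity, format "m # s").

(** Makes the closed formula [inv_kostka_coef] available for [inv_kostka], which
is only given by an existence proof, through uniqueness. *)
Lemma inv_kostka_coefP : is_inv_kostka inv_kostka_coef.
Proof.
split=> [mu la ne|n mu]; first exact: kostka_coef_deg.
have nz : tofrac (alternant (delta n)) != 0.
  by rewrite tofrac_eq0 alternant_delta_neq0.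
apply: (mulIf nz); rewrite -tofracM mono_alt raddf_sum /= mulr_suml big_mkcond /=.
apply: eq_bigr => la _; rewrite /schur; case: ifP => _; last first.
  by rewrite mulr0 mul0r.
by rewrite tofracM rmorph_int -mulrA divfK.
Qed.

(** Any number of variables that is at least l(la) computes the same number;
the freedom to take [n = l] for every shifted partition is what lets one group
of permutations serve all of them. *)
Lemma inv_kostkaE n mu la : (size la <= n)%N ->
  inv_kostka mu la = kostka_coef mu (topmon n la).
Proof.
move=> sz; rewrite kostka_coefE //.
exact: inv_kostka_unique inv_kostkaP inv_kostka_coefP mu la.
Qed.

Lemma sumn_mdeg n (w : 'X_{1..n}) : sumn w = mdeg w.
Proof. by rewrite /mdeg sumnE. Qed.

(** For a fixed permutation exactly one mu in the sum over partitions matches the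
rearranged difference vector, once that vector is nonnegative. *)
Lemma sum_inv_kostka n la (P : pred intpart) (f : intpart -> {poly int}) :
  (size la <= n)%N ->
  \sum_(mu <- partitions (sumn la) | P mu) inv_kostka mu la *: f mu =
  \sum_(s : 'S_n | (delta n # s <= topmon n la)%MM &&
                   P (part_of (topmon n la - delta n # s)%MM))
    (-1) ^+ s *: f (part_of (topmon n la - delta n # s)%MM).
Proof.
move=> sz; under eq_bigr do rewrite (inv_kostkaE _ sz) scaler_suml.
rewrite exchange_big [RHS]big_mkcond; apply: eq_bigr => s _.
set w := (_ - _)%MM; have [le|_] := boolP (_ <= _)%MM; last first.
  by rewrite big1 // => mu _; rewrite mulr0 scale0r.
have wP : part_of w \in partitions (sumn la).
  rewrite mem_partitions sumn_part_of sumn_mdeg.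
  have := congr1 (@mdeg n) (submK le).
  by rewrite mdegD mdeg_mperm mdeg_topmon // => /addIn ->.
rewrite big_mkcond (bigD1_seq _ wP (partitions_uniq _)) /= eqxx mulr1.
rewrite big1 ?addr0 // => mu /negbTE ne.
by rewrite eq_sym ne mulr0 scale0r if_same.
Qed.

(** * Statistics of a vector read off its partition *)

Lemma part_of_pad (s : seq nat) :
  perm_eq (part_of s ++ nseq (size s - size (part_of s)) 0%N) s.
Proof.
rewrite perm_sym -(perm_filterC (ltn 0) s) perm_sym /=.
rewrite perm_cat ?perm_sort // size_sort size_filter.
have -> : (size s - count (ltn 0) s)%N = size (filter (predC (ltn 0)) s).
  by rewrite size_filter -(count_predC (ltn 0) s) addKn.
have /all_pred1P <- // : all (pred1 0%N) (filter (predC (ltn 0)) s).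
by apply/allP => x; rewrite mem_filter /= -leqNgt leqn0 => /andP[].
Qed.

Lemma size_part_of (s : seq nat) : (size (part_of s) <= size s)%N.
Proof. by rewrite size_sort size_filter count_size. Qed.

Lemma size_part_of_lt (s : seq nat) :
  (size (part_of s) < size s)%N = (0%N \in s).
Proof.
rewrite size_sort size_filter ltn_neqAle count_size andbT -all_count.
rewrite -has_pred1 -[RHS]negbK -all_predC; congr (~~ _).
by apply: eq_all => x /=; rewrite lt0n.
Qed.

Lemma nth_part_of (s : seq nat) i :
  sorted geq s -> nth 0%N (part_of s) i = nth 0%N s i.
Proof.
move=> ss; rewrite -(nth_cat0 _ (size s - size (part_of s))).
congr nth; apply: (sorted_eq geq_trans geq_asym) ss (part_of_pad s).
rewrite (sorted_pairwise geq_trans) pairwise_cat -!(sorted_pairwise geq_trans).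
apply/and3P; split.
- by apply/allrelP => x y _; rewrite mem_nseq => /andP[_ /eqP->].
- by case/andP: (valP (part_of s)).
- by case: (_ - _)%N => //= k; elim: k.
Qed.

(** Sums over the first [n] parts, padded by zeros, do not see the rearrangement
of a vector of length [n]; this holds even when [F 0] is not zero, as happens
for the shifted squares. *)
Lemma sum_part_of n (w : 'X_{1..n}) (F : nat -> nat) :
  (\sum_(i < n) F (nth 0 (part_of w) i) = \sum_(i < n) F (w i))%N.
Proof.
have sw : size w = n by rewrite size_tuple.
have pE := part_of_pad w; have sE := perm_size pE; rewrite [RHS]sw in sE.
transitivity (\sum_(x <- w) F x)%N.
  rewrite -(perm_big _ pE) (big_nth 0%N) sE big_mkord.
  by apply: eq_bigr => i _; rewrite nth_cat0.
by rewrite (big_nth 0%N) sw big_mkord; apply: eq_bigr => i _; rewrite -mnm_nth.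
Qed.

Lemma sqnorm_sum n la : (size la <= n)%N ->
  sqnorm la = (\sum_(i < n) nth 0 la i ^ 2)%N.
Proof.
move=> sz; have -> : sqnorm la = (\sum_(x <- la ++ nseq (n - size la) 0%N) x ^ 2)%N.
  by rewrite big_cat big_nseq iter_fix //= addn0.
rewrite (big_nth 0%N) size_cat size_nseq subnKC // big_mkord.
by apply: eq_bigr => i _; rewrite nth_cat0.
Qed.

(** * Each permutation contributes to exactly one shift *)

(** The largest [- x_i], truncated at 0, where [x_i = la_i + s(i) - i]: the least
[r] for which all [x_i + r] are nonnegative. *)
Definition depth l la (s : 'S_l) : nat :=
  (\max_(i < l) (delta l (s i) - topmon l la i))%N.

Lemma depth_lt l la (s : 'S_l) : (0 < l)%N -> (depth la s < l)%N.
Proof.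
move=> l_gt0; rewrite -[X in (_ < X)%N](ltn_predK l_gt0) ltnS.
by apply/bigmax_leqP => i _; rewrite mnmE; lia.
Qed.

Lemma depth_le l la (s : 'S_l) r :
  (depth la s <= r)%N = [forall i, delta l (s i) <= topmon l la i + r]%N.
Proof.
apply/bigmax_leqP/forallP => [h i|h i _]; last by rewrite leq_subLR.
by rewrite -leq_subLR h.
Qed.

Lemma nth_part_anti la i j : (i <= j)%N -> (nth 0%N la j <= nth 0%N la i)%N.
Proof.
move=> le; case: (ltnP j (size la)) => hj; last by rewrite nth_default.
case/andP: (valP la) => s0 _.
by apply: (sorted_leq_nth geq_trans leqnn 0%N s0) (leq_ltn_trans le hj) hj le.
Qed.

Lemma topmon_add_rect l la r (i : 'I_l) :
  topmon l (add_rect l r la) i = (topmon l la i + r)%N.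
Proof.
rewrite !mnmE nth_part_of; first by rewrite nth_mkseq // addnAC.
apply/(sortedP 0%N) => k; rewrite size_mkseq => lt.
by rewrite !nth_mkseq ?(ltnW lt) //= leq_add2r nth_part_anti.
Qed.

Lemma size_add_rect l r la : (size (add_rect l r la) <= l)%N.
Proof. by apply: leq_trans (size_part_of _) _; rewrite size_mkseq. Qed.

(** The square norm of the vector with entries [la_i + s(i) - i]. *)
Definition weight l la (s : 'S_l) : nat :=
  (\sum_(i < l) absz ((topmon l la i)%:Z - (delta l (s i))%:Z)%R ^ 2)%N.

Lemma sum_depth0 l la : (size la <= l)%N ->
  \sum_(mu <- partitions (sumn la)) inv_kostka mu la *: qhalf ^+ sqnorm mu =
  \sum_(s : 'S_l | depth la s == 0%N) (-1) ^+ s *: qhalf ^+ weight la s.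
Proof.
move=> la_le; rewrite (sum_inv_kostka xpredT _ la_le).
have E (s : 'S_l) : (delta l # s <= topmon l la)%MM = (depth la s == 0%N).
  rewrite -leqn0 depth_le; apply/mnm_lepP/forallP => h i; move: (h i).
    by rewrite addn0 [X in (X <= _)%N]mnmE.
  by rewrite addn0 [X in _ -> (X <= _)%N]mnmE.
apply: eq_big => [s|s]; rewrite E andbT // -E => /mnm_lepP le.
congr (_ *: qhalf ^+ _); rewrite (@sqnorm_sum l); last first.
  by apply: leq_trans (size_part_of _) _; rewrite size_tuple.
rewrite (sum_part_of _ (expn^~ 2)); apply: eq_bigr => i _; congr (_ ^ 2)%N.
move: (le i); rewrite mnmBE [(_ # _) i]mnmE; lia.
Qed.

(** The restriction to fewer than [l] parts turns [depth la s <= r] into an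
equality: some entry of the nonnegative vector [x(s) + r] is 0. *)
Lemma sum_depth l la r : (0 < r)%N ->
  \sum_(mu <- partitions (sumn (add_rect l r la)) | (size mu < l)%N)
     inv_kostka mu (add_rect l r la) *: qhalf ^+ sqdist l r mu =
  \sum_(s : 'S_l | depth la s == r) (-1) ^+ s *: qhalf ^+ weight la s.
Proof.
move=> r_gt0.
rewrite (sum_inv_kostka _ _ (size_add_rect l r la)).
pose p := topmon l (add_rect l r la).
have le_depth (s : 'S_l) : (delta l # s <= p)%MM = (depth la s <= r)%N.
  rewrite depth_le; apply/mnm_lepP/forallP => h i; move: (h i).
    by rewrite topmon_add_rect [X in (X <= _)%N]mnmE.
  by rewrite topmon_add_rect [X in _ -> (X <= _)%N]mnmE.
have wE (s : 'S_l) (i : 'I_l) :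
    (p - delta l # s)%MM i = (topmon l la i + r - delta l (s i))%N.
  by rewrite mnmBE topmon_add_rect [X in (_ - X)%N]mnmE.
apply: eq_big => [s|s].
  rewrite le_depth -[X in (_ < X)%N](size_tuple (p - delta l # s)%MM).
  rewrite size_part_of_lt eqn_leq; apply: andb_id2l => le.
  (* Negating [depth la s <= r.-1] yields an [i] with [- x_i >= r]. *)
  rewrite -[(r <= _)%N]negbK -ltnNge -[r in (_ < r)%N](ltn_predK r_gt0).
  rewrite ltnS depth_le negb_forall.
  apply/tnthP/existsP => -[i Ei]; exists i; move: Ei;
    rewrite -/(fun_of_multinom _ _) wE; lia.
rewrite le_depth => /andP[]; rewrite depth_le => /forallP le _.
congr (_ *: qhalf ^+ _); rewrite /sqdist.
rewrite (sum_part_of _ (fun x => absz (x%:Z - r%:Z)%R ^ 2)%N).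
apply: eq_bigr => i _; congr (_ ^ 2)%N; move: (le i); rewrite wE; lia.
Qed.

Lemma sum_all_depths l la : (0 < l)%N -> (size la <= l)%N ->
  \sum_(mu <- partitions (sumn la)) inv_kostka mu la *: qhalf ^+ sqnorm mu
  + \sum_(1 <= r < l)
      \sum_(mu <- partitions (sumn (add_rect l r la)) | (size mu < l)%N)
        inv_kostka mu (add_rect l r la) *: qhalf ^+ sqdist l r mu
  = \sum_(s : 'S_l) (-1) ^+ s *: qhalf ^+ weight la s.
Proof.
move=> l_gt0 la_le; rewrite (sum_depth0 la_le).
pose D r := \sum_(s : 'S_l | depth la s == r) (-1) ^+ s *: qhalf ^+ weight la s.
rewrite (eq_big_nat _ _ (F2 := D)) => [|r /andP[r_gt0 _]]; last exact: sum_depth.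
rewrite -[LHS](@big_ltn _ _ _ 0 l D) // big_mkord.
by rewrite [RHS](partition_big (fun s => Ordinal (depth_lt la s l_gt0)) xpredT).
Qed.

(** * The Vandermonde evaluation *)

(** Expand the squares of [x_i = (la_i - i) + s(i)], where only the cross terms
[2 (la_i - i) s(i)] depend on [s] after summation.  Adding [2 (l - 1) s(i)] to
each turns [la_i - i] into the natural number [p_i], which keeps every exponent
nonnegative. *)
Lemma weightE l la (s : 'S_l) :
  (weight la s + (\sum_(i < l) i) * l.-1 * 2 =
   \sum_(i < l) (absz ((nth 0%N la i)%:Z - i%:Z)%R ^ 2 + i ^ 2)
   + 2 * \sum_(i < l) topmon l la i * s i)%N.
Proof.
have sumE F : (\sum_(i < l) F i = \sum_(i < l) F (s i))%N.
  exact: reindex_inj perm_inj.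
rewrite big_split (sumE (fun i : 'I_l => i ^ 2)%N) (sumE (@nat_of_ord l)) /=.
rewrite /weight !big_distrl big_distrr -!big_split; apply: eq_bigr => i _ /=.
rewrite !mnmE; have := ltn_ord i; have := ltn_ord (s i).
move: (nth 0%N la i) (i : nat) (s i : nat) => x a b hb ha.
nia.
Qed.

(** Multiplied by [q^((l - 1) \sum_i i)], the sum becomes a power of [qhalf] times
the Vandermonde determinant in the [q^(p_i)], whose factors are
[q^(p_j) - q^(p_i) = q^(p_j) (1 - q^(p_i - p_j))] for [i < j]. *)
Lemma sum_weight l la : (size la <= l)%N ->
  \sum_(s : 'S_l) (-1) ^+ s *: qhalf ^+ weight la s =
  qhalf ^+ sqnorm la * \prod_(i < l) \prod_(j < l | (i < j)%N)
    (1 - q ^+ (nth 0%N la i - nth 0%N la j + (j - i))%N).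
Proof.
move=> la_le; pose N := ((\sum_(i < l) i) * l.-1 * 2)%N.
pose B := (\sum_(i < l) (absz ((nth 0%N la i)%:Z - i%:Z)%R ^ 2 + i ^ 2))%N.
have qN0 : qhalf ^+ N != 0 by rewrite expf_neq0 // polyX_eq0.
apply: (mulIf qN0).
transitivity (qhalf ^+ B *
  \det (Vandermonde l (\row_i q ^+ topmon l la i))).
  rewrite -det_tr /determinant mulr_suml mulr_sumr; apply: eq_bigr => s _.
  rewrite -scalerAl -exprD weightE exprD scaler_sign -mulr_sign mulrCA.
  congr (_ * (_ * _)).
  rewrite exprM -prodrXr; apply: eq_bigr => i _.
  by rewrite !mxE exprM.
rewrite det_Vandermonde.
have -> : \prod_(i < l) \prod_(j < l | (i < j)%N)
    ((\row_k q ^+ topmon l la k) 0 j - (\row_k q ^+ topmon l la k) 0 i) =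
  q ^+ (\sum_(j < l) topmon l la j * j)%N *
  \prod_(i < l) \prod_(j < l | (i < j)%N)
    (1 - q ^+ (nth 0%N la i - nth 0%N la j + (j - i))%N).
  rewrite -prodrXr.
  (* [p_j] is collected once for each of the [j] indices [i < j]. *)
  have -> : \prod_(i < l) q ^+ (topmon l la i * i) =
     \prod_(i < l) \prod_(j < l | (i < j)%N) q ^+ topmon l la j.
    rewrite (exchange_big_dep xpredT) //=; apply: eq_bigr => j _.
    rewrite exprM prodr_const; congr (_ ^+ _).
    rewrite -sum1_card (big_ord_narrow (ltnW (ltn_ord j))).
    by rewrite sum1_card card_ord.
  rewrite -big_split /=; apply: eq_bigr => i _.
  rewrite -big_split /=; apply: eq_bigr => j lt_ij.
  rewrite !mxE mulrBr mulr1 -exprD; congr (_ - _ ^+ _).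
  by rewrite !mnmE; have := nth_part_anti la (ltnW lt_ij); have := ltn_ord j; lia.
rewrite [LHS]mulrA [RHS]mulrAC; congr (_ * _).
rewrite /q -exprM -!exprD; congr (_ ^+ _).
rewrite (sqnorm_sum la_le) /B /N !big_distrl big_distrr -!big_split.
apply: eq_bigr => i _ /=; rewrite !mnmE; have := ltn_ord i.
move: (nth 0%N la i) (i : nat) => x a ha.
nia.
Qed.

(** * The identity and its specialization to the empty partition *)

Lemma add_rect_nil l r : add_rect l r (part_of [::]) = rect l r.
Proof.
congr part_of; apply: (@eq_from_nth _ 0%N); rewrite size_mkseq ?size_nseq //.
by move=> i lt_i; rewrite nth_mkseq // nth_nseq lt_i nth_nil.
Qed.

Theorem corollary4p2 (l : nat) (l_ge1 : (1 <= l)%N) :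
  (forall la : intpart, (size la <= l)%N ->
     \sum_(mu <- partitions (sumn la)) inv_kostka mu la *: qhalf ^+ sqnorm mu
     + \sum_(1 <= r < l)
         \sum_(mu <- partitions (sumn (add_rect l r la)) | (size mu < l)%N)
           inv_kostka mu (add_rect l r la) *: qhalf ^+ sqdist l r mu
     = qhalf ^+ sqnorm la
       * \prod_(i < l) \prod_(j < l | (i < j)%N)
           (1 - q ^+ (nth 0%N la i - nth 0%N la j + (j - i))%N))
  /\
  \sum_(0 <= r < l)
    \sum_(mu <- partitions (sumn (rect l r)) | (size mu < l)%N)
      inv_kostka mu (rect l r) *: qhalf ^+ sqdist l r mu
  = \prod_(i < l) \prod_(j < l | (i < j)%N) (1 - q ^+ (j - i)%N).
Proof.
have main (la : intpart) (la_le : (size la <= l)%N) :=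
  etrans (sum_all_depths l_ge1 la_le) (sum_weight la_le).
split=> //; have := main (part_of [::]) isT.
have -> : sqnorm (part_of [::]) = 0%N by rewrite /sqnorm big_nil.
rewrite mul1r.
under [in RHS]eq_bigr do under eq_bigr do rewrite !nth_nil sub0n add0n.
move=> <-; rewrite big_ltn //; congr (_ + _); last first.
  by apply: eq_bigr => r _; rewrite add_rect_nil.
(* For [r = 0] the length condition is automatic, as mu is empty and [0 < l]. *)
have -> : rect l 0 = part_of [::] by apply: (part_of_cat0 [::] l).
rewrite big_seq_cond [RHS]big_seq_cond; apply: eq_big => [mu|mu].
  rewrite mem_partitions andbT andb_idr // => /eqP mu0.
  by apply: leq_ltn_trans (size_part mu) _; rewrite mu0.
rewrite mem_partitions => /andP[_ szmu]; congr (_ *: _ ^+ _).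
rewrite (sqnorm_sum (ltnW szmu)); apply: eq_bigr => i _.
by rewrite subr0.
Qed.
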